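(* For every $n\geq0$, the map $\phi:\mathsf{Sh}_n\to\mathcal{I}_{n+1}(1234,1243)$ defined below is well defined (its image consists of involutions of $[n+1]$ avoiding both $1234$ and $1243$) and is a bijection.
   Context: A Schröder path of length $2n$ is a lattice path from $(0,0)$ to $(2n,0)$ with steps $\mathsf{h}=(2,0)$, $\mathsf{u}=(1,1)$, $\mathsf{d}=(1,-1)$ never going below the $x$-axis; it is symmetric if it is symmetric about the line $x=n$. $\mathsf{Sh}_n$ is the set of symmetric Schröder paths of length $2n$. Involutions, pattern avoidance and $\mathcal{I}_m(T)$ (involutions of $[m]$ avoiding every pattern in $T$) are as usual. The map $\phi$: given $p\in\mathsf{Sh}_n$ (as a word in $\mathsf{u},\mathsf{d},\mathsf{h}$), form the word $p'$ by appending a letter $\mathsf{h}$ at the end, replacing every factor $\mathsf{u}\mathsf{d}$ by a letter $\mathsf{r}$, and deleting all remaining $\mathsf{d}$'s; $p'=p_1\cdots p_{n+1}\in\{\mathsf{u},\mathsf{r},\mathsf{h}\}^{n+1}$. For $x\in\{\mathsf{h},\mathsf{r},\mathsf{u}\}$ let $A_x=\{i: p_i=x\}$. For each $x$, if $A_x=\{i_1<\dots<i_\ell\}$, set $\pi_{i_j}=i_{\ell+1-j}$ for $1\le j\le\ell$. Then $\phi(p)=\pi=\pi_1\cdots\pi_{n+1}$. *)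

(* Defs.v *)
From HB Require Import structures.
From mathcomp Require Import all_boot.
Set Implicit Arguments. Unset Strict Implicit. Unset Printing Implicit Defensive.

(* Letters: steps u=(1,1), d=(1,-1), h=(2,0); and the extra letter r of p'. *)
Inductive letter := U | D | H | R.

Definition letter_eqb (x y : letter) : bool :=
  match x, y with
  | U, U | D, D | H, H | R, R => true
  | _, _ => false
  end.

Lemma letter_eqP : Equality.axiom letter_eqb.
Proof. by case; case; constructor. Qed.

HB.instance Definition _ := hasDecEq.Build letter letter_eqP.

Definition width (x : letter) : nat := if x is H then 2 else 1.

Fixpoint walk (h : nat) (p : seq letter) : option nat :=
  match p with
  | [::] => Some h
  | U :: q => walk h.+1 q
  | D :: q => if h is h'.+1 then walk h' q else None
  | _ :: q => walk h q
  end.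

Definition schroeder (n : nat) (p : seq letter) : bool :=
  [&& all (fun x => x != R) p, sumn (map width p) == 2 * n & walk 0 p == Some 0].

(* reflection about the vertical line x = n swaps u and d and reverses *)
Definition flip (x : letter) : letter :=
  match x with U => D | D => U | y => y end.

Definition symmetric_path (p : seq letter) : bool := rev (map flip p) == p.

Definition Sh (n : nat) (p : seq letter) : bool := schroeder n p && symmetric_path p.

Fixpoint compress (p : seq letter) : seq letter :=
  match p with
  | U :: D :: q => R :: compress q
  | D :: q => compress q
  | x :: q => x :: compress q
  | [::] => [::]
  end.

Definition pprime (p : seq letter) : seq letter := compress (rcons p H).

Definition Aset (w : seq letter) (x : letter) : seq nat :=
  [seq i <- iota 1 (size w) | nth H w i.-1 == x].

(* pi_{i_j} = i_{l+1-j}; permutation in one-line notation (values in 1..m) *)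
Definition phi_word (w : seq letter) : seq nat :=
  [seq let A := Aset w (nth H w i.-1) in nth 0 (rev A) (index i A)
  | i <- iota 1 (size w)].

Definition phi (p : seq letter) : seq nat := phi_word (pprime p).

Definition is_perm (m : nat) (s : seq nat) : bool := perm_eq s (iota 1 m).

Definition is_involution (m : nat) (s : seq nat) : bool :=
  is_perm m s && all (fun i => nth 0 s (nth 0 s i.-1).-1 == i) (iota 1 m).

Definition contains (s pat : seq nat) : Prop :=
  exists t : seq nat, [/\ subseq t s, size t = size pat &
    forall i j, i < size pat -> j < size pat ->
      (nth 0 t i < nth 0 t j) = (nth 0 pat i < nth 0 pat j)].

Definition avoids (s pat : seq nat) : Prop := ~ contains s pat.

Definition I_1234_1243 (m : nat) (s : seq nat) : Prop :=
  [/\ is_involution m s, avoids s [:: 1; 2; 3; 4] & avoids s [:: 1; 2; 4; 3]].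

(* Main.v *)
(** Read a symmetric Schröder path from both ends towards its axis.  The word [p'] without its last
    [H] is consumed from both ends as well: a horizontal step takes an [H] off both ends, a peak
    takes an [R] off both ends, an up-step outside a peak takes a [U] off the left end, and such a
    down-step takes a [U] off the right end (the [U] of its mirror image).  In terms of the
    involution [f], at each stage the unmatched positions are the list [Q] of the [U]'s taken off
    the left, an unread interval [a, a + k) and one position [e] of an [H] (at first the
    appended one).  The next move can be read off [f]: it is a down-step if [f] sends the first
    element of [Q] to [a + k - 1], and otherwise a horizontal step, a peak or an up-step according
    to whether [f a] is [e], [a + k - 1] or something else.  Hence the path is recovered from the
    involution.  Since 1234 and 1243 both consist of a 1, then a 2, then two larger entries, a
    matched pair put back by a move never takes part in such a pattern; conversely, if [f] avoids
    them then this reading never gets stuck, since [f] stays decreasing on [Q] and [a <= f e]. *)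
Require Import Defs.
From mathcomp Require Import all_boot.
From mathcomp Require Import zify.
Set Implicit Arguments. Unset Strict Implicit. Unset Printing Implicit Defensive.

(** * Symmetric paths read from both ends, and their compressed words *)

(* [mid t p v]: [p] is the middle part, from height [t] back to height [t], of a symmetric path, and
   [v] is the corresponding factor of [p'].  The side condition of [mid_U] says that the up-step
   does not start a peak. *)
Inductive mid : nat -> seq letter -> seq letter -> Prop :=
| mid_nil t : mid t [::] [::]
| mid_h t : mid t [:: H] [:: H]
| mid_r t : mid t [:: U; D] [:: R]
| mid_D t p v : mid t p v -> mid t.+1 (D :: rcons p U) (rcons v U)
| mid_H t p v : mid t p v -> mid t (H :: rcons p H) (H :: rcons v H)
| mid_R t p v : mid t p v -> mid t (U :: D :: rcons (rcons p U) D) (R :: rcons v R)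
| mid_U t p v : mid t.+1 p v -> head D p != D -> mid t (U :: rcons p D) (U :: v).

Lemma walk_rcons t p x :
  walk t (rcons p x) = if walk t p is Some h then walk h [:: x] else None.
Proof.
elim: p t => [|y p IHp] t //=; case: y => //=.
by case: t.
Qed.

Lemma symmetric_path_rcons x p y :
  symmetric_path (x :: rcons p y) = (y == flip x) && symmetric_path p.
Proof.
rewrite /symmetric_path /= map_rcons rev_cons rev_rcons /= eqseq_cons eqseq_rcons.
by case: (rev _ == p); case: x; case: y.
Qed.

Lemma mid_walk t p v : mid t p v -> walk t p = Some t.
Proof.
elim=> // {t p v} t p v _ IH => [||| _] /=; rewrite !walk_rcons /= IH //.
Qed.

Lemma mid_noR t p v : mid t p v -> all (fun x => x != R) p.
Proof.
elim=> // {t p v} t p v _ IH => [||| _] /=; rewrite !all_rcons /= IH //.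
Qed.

Lemma mid_width t p v : mid t p v -> sumn (map width p) = 2 * size v.
Proof.
elim=> // {t p v} t p v _ IH => [||| _] /=; rewrite !map_rcons !sumn_rcons ?size_rcons /= IH; lia.
Qed.

Lemma mid_symmetric t p v : mid t p v -> symmetric_path p.
Proof.
elim=> // {t p v} t p v _ IH => [||| _]; rewrite ?symmetric_path_rcons //.
by rewrite -rcons_cons !symmetric_path_rcons.
Qed.

(** The last step is the mirror image of the first. The default values make the empty path fail both
    conditions. *)
Lemma symmetric_last p : symmetric_path p -> head D p != D -> last U p != U.
Proof.
case: (lastP p) => // q y; case: q => [|x q] /=.
  by case: y.
rewrite symmetric_path_rcons last_rcons => /andP [/eqP -> _].
by case: x.
Qed.

(** Only a down-step writes a [U] at the right end of [v]. Up-steps leave that end alone, so it is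
    decided by the first step of another kind. This is how [decode] later tells an up-step from a
    down-step. *)
Lemma mid_last t p v : mid t p v -> head D p != D -> last U v != U.
Proof.
elim=> // {t p v} t p v.
- by rewrite /= last_rcons.
- by rewrite /= last_rcons.
by move=> _ IH hp _ /=; apply: IH.
Qed.

(** The only interaction between [p] and [s] is a peak straddling their junction, which the side
    condition excludes. In the case [mid_U], the symmetry of [p] shows that the appended [D] does
    not close a peak either. *)
Lemma compress_mid t p v s : mid t p v -> (last H p != U) || (head H s != D) ->
  compress (p ++ s) = v ++ compress s.
Proof.
move=> m; elim: m s => // {t p v} t p v.
- move=> m IH s; rewrite last_cons last_rcons eqxx /= !cat_rcons => hs.
  rewrite IH ?orbT //; congr (v ++ _).
  by case: s hs => //; case.
- by move=> m IH s _; rewrite /= !cat_rcons IH ?orbT.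
- by move=> m IH s _; rewrite /= !cat_rcons IH ?orbT.
move=> m IH hp s _.
have lp := symmetric_last (mid_symmetric m) hp.
have compressU q : head D q != D -> compress (U :: q) = U :: compress q by case: q => //; case.
rewrite !cat_cons cat_rcons compressU; last by case: p hp {m IH lp}.
by rewrite IH //; case: p lp {IH hp m} => //= x p ->.
Qed.

(** The outer steps are mirror images, so they can be stripped together. The induction is on a bound
    for the length, since a peak at each end removes four steps at once. *)
Lemma mid_exists p t : all (fun x => x != R) p -> walk t p = Some t ->
  symmetric_path p -> exists v, mid t p v.
Proof.
have [m] := ubnP (size p); elim: m p t => // m IH p t.
case: p => [|x p] /=; first by exists [::]; constructor.
case: (lastP p) => [|p1 y] {p} sp.
  by case: x => // _ _ _; exists [:: H]; constructor.
rewrite size_rcons ltnS in sp.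
rewrite all_rcons symmetric_path_rcons => /and3P [xR yR aR] + /andP [/eqP ey sym].
rewrite {}ey {yR}; case: x xR => // _ /=.
- rewrite walk_rcons; case w1: (walk t.+1 p1) => [[|h]|] //= [eh].
  rewrite eh in w1.
  have [hp|hp] := eqVneq (head D p1) D; last first.
    have [v mv] := IH _ _ (ltnW sp) aR w1 sym.
    by exists (U :: v); constructor.
  case: p1 hp sp aR sym w1 => [|x p1] /=; first by exists [:: R]; constructor.
  move=> -> {x}; case: (lastP p1) => // p2 z {p1}.
  rewrite size_rcons all_rcons symmetric_path_rcons => sp /and3P [_ _ aR] /andP [/eqP -> sym].
  rewrite walk_rcons /=; case w2: (walk t p2) => [h2|] //= [e2]; rewrite e2 in w2.
  have [v mv] := IH _ _ (ltnW (ltnW (ltnW sp))) aR w2 sym.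
  by exists (R :: rcons v R); constructor.
- case: t => // t; rewrite walk_rcons /=; case w2: (walk t p1) => [h2|] //= [e2]; rewrite e2 in w2.
  have [v mv] := IH _ _ (ltnW sp) aR w2 sym.
  by exists (rcons v U); constructor.
rewrite walk_rcons /=; case w2: (walk t p1) => [h2|] //= [e2]; rewrite e2 in w2.
have [v mv] := IH _ _ (ltnW sp) aR w2 sym.
by exists (H :: rcons v H); constructor.
Qed.

Lemma Sh_mid n p : Sh n p -> exists2 v, mid 0 p v & size v = n.
Proof.
case/andP=> /and3P [aR /eqP wp /eqP wk] sym.
have [v mv] := mid_exists aR wk sym.
exists v => //; have := mid_width mv; lia.
Qed.

Lemma mid_Sh p v : mid 0 p v -> Sh (size v) p.
Proof.
move=> m; rewrite /Sh /schroeder (mid_noR m) (mid_width m) (mid_walk m).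
by rewrite (mid_symmetric m) !eqxx.
Qed.

Lemma pprime_mid t p v : mid t p v -> pprime p = rcons v H.
Proof. by move=> m; rewrite /pprime -cats1 (compress_mid m) ?orbT // -cats1. Qed.

(** * Involutions labelled by letters *)

Definition inv_on (X : pred nat) (f : nat -> nat) : Prop :=
  forall x, X x -> X (f x) /\ f (f x) = x.

(** Together with [inv_on], this characterises the map that reverses each class of equally labelled
    positions, which is how [phi] is defined. *)
Definition fits (X : pred nat) (L : nat -> letter) (f : nat -> nat) : Prop :=
  (forall x, X x -> L (f x) = L x) /\
  (forall x y, X x -> X y -> x < y -> L x = L y -> f y < f x).

(* Avoidance of 1234 and 1243 at once: the last two values are not compared. *)
Definition avoid_on (X : pred nat) (f : nat -> nat) : Prop :=
  forall x1 x2 x3 x4, X x1 -> X x2 -> X x3 -> X x4 ->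
  x1 < x2 -> x2 < x3 -> x3 < x4 -> f x1 < f x2 -> f x2 < f x3 -> f x2 < f x4 -> False.

Definition dom (Q : seq nat) (a k e : nat) : pred nat :=
  fun x => [|| x \in Q, a <= x < a + k | x == e].

Definition layout (Q : seq nat) (a k e : nat) : Prop :=
  [/\ sorted ltn Q, (forall x, x \in Q -> x < a) & a + k <= e].

Definition labels (L : nat -> letter) (Q : seq nat) (a e : nat) (v : seq letter) : Prop :=
  [/\ forall x, x \in Q -> L x = U, map L (iota a (size v)) = v & L e = H].

(** Here [k] counts the unread letters; a horizontal step or a peak read when one letter is left
    lies on the axis and is not doubled. A horizontal step matches [a] with the old [e], so the [H]
    at the right end of the interval becomes the new [e]. *)
Fixpoint decode (f : nat -> nat) (k : nat) (Q : seq nat) (a e : nat) : seq letter :=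
  if k is k1.+1 then
    if (Q != [::]) && (f (head 0 Q) == a + k1) then
      D :: rcons (decode f k1 (behead Q) a e) U
    else if f a == e then
      if k1 is k2.+1 then H :: rcons (decode f k2 Q a.+1 (a + k1)) H else [:: H]
    else if f a == a + k1 then
      if k1 is k2.+1 then U :: D :: rcons (rcons (decode f k2 Q a.+1 e) U) D
      else [:: U; D]
    else U :: rcons (decode f k1 (rcons Q a) a.+1 e) D
  else [::].

Lemma inv_on_eq (X Y : pred nat) f : X =1 Y -> inv_on X f -> inv_on Y f.
Proof. by move=> XY iX x; rewrite -!XY => /iX. Qed.

Lemma inv_on_inj X f x y : inv_on X f -> X x -> X y -> f x = f y -> x = y.
Proof. by move=> iX /iX [_ {2}<-] /iX [_ {2}<-] ->. Qed.

Lemma inv_on_sub (X Y : pred nat) f a b : inv_on X f -> f a = b -> f b = a ->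
  (forall x, Y x = [&& X x, x != a & x != b]) -> inv_on Y f.
Proof.
move=> iX fa fb YX x; rewrite !YX => /and3P [Xx xa xb].
have [Xfx ffx] := iX _ Xx; split=> //; rewrite Xfx /=.
by apply/andP; split; apply/eqP => e; move: ffx xa xb; rewrite e ?fa ?fb => ->; rewrite eqxx.
Qed.

Lemma fits_sub (X Y : pred nat) L f : (forall x, Y x -> X x) -> fits X L f -> fits Y L f.
Proof. by move=> YX [h1 h2]; split=> [x /YX /h1 //|x y /YX Xx /YX]; apply: h2. Qed.

Lemma avoid_sub (X Y : pred nat) f : (forall x, Y x -> X x) -> avoid_on X f -> avoid_on Y f.
Proof.
move=> YX av x1 x2 x3 x4 /YX X1 /YX X2 /YX X3 /YX X4; exact: av.
Qed.

(** A decreasing involution of a class swaps its least and greatest elements: if [f a < b],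
    monotonicity would give [f b < a]. *)
Lemma fits_extreme X L f a b : inv_on X f -> fits X L f -> X a -> X b -> L a = L b ->
  (forall x, X x -> L x = L a -> a <= x <= b) -> f a = b /\ f b = a.
Proof.
move=> iX [fL fd] Xa Xb Lab ext.
have [Xfa ffa] := iX _ Xa; have [Xfb ffb] := iX _ Xb.
have := ext _ Xfa (fL _ Xa); have := ext _ Xfb; rewrite fL // => /(_ (esym Lab)) hb ha.
have [lt|] := ltnP (f a) b; last by move=> h; have e : f a = b by [lia]; split=> //; rewrite -e.
by have := fd _ _ Xfa Xb lt; rewrite fL // => /(_ Lab); lia.
Qed.

(** Putting a matched pair around the remaining members of its class keeps [f] decreasing there. The
    case [a = b] adds a fixed point. *)
Lemma fits_add (X Y : pred nat) L f a b : inv_on Y f -> f a = b -> f b = a -> L a = L b ->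
  (forall x, X x -> [|| Y x, x == a | x == b]) ->
  (forall x, Y x -> L x = L a -> a < x < b) ->
  a <= b -> fits Y L f -> fits X L f.
Proof.
move=> iY fa fb Lab XY btw ab [fL fd]; split.
  move=> x /XY /or3P [/fL //|/eqP ->|/eqP ->]; by rewrite ?fa ?fb.
move=> x y /XY /or3P [Yx|/eqP ->|/eqP ->] /XY /or3P [Yy|/eqP ->|/eqP ->] xy Lxy;
  rewrite ?fa ?fb; try lia.
- exact: fd.
- by have := btw _ Yx Lxy; lia.
- have [Yfx _] := iY _ Yx; have := btw _ Yfx; rewrite fL // Lxy => /(_ (esym Lab)); lia.
- have [Yfy _] := iY _ Yy; have := btw _ Yfy; rewrite fL // -Lxy => /(_ erefl); lia.
- by have := btw _ Yy; rewrite -Lxy => /(_ (esym Lab)); lia.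
Qed.

(** * Unmatched positions before and after each move *)

Lemma domP (Q : seq nat) (a k e x : nat) :
  reflect [\/ x \in Q, a <= x < a + k | x = e] (dom Q a k e x).
Proof.
rewrite /dom; apply: (iffP idP).
  by move/or3P; case=> [?|?|/eqP ?]; [apply: Or31 | apply: Or32 | apply: Or33].
by case=> [->|->|->]; rewrite ?eqxx ?orbT.
Qed.

Lemma layout_head q Q a k e x : layout (q :: Q) a k e -> x \in Q -> q < x.
Proof. by case=> /= /(order_path_min ltn_trans) /allP h _ _ /h. Qed.

Lemma layout_D q Q a k e : layout (q :: Q) a k.+1 e -> layout Q a k e.
Proof.
case=> /= /path_sorted sQ lt le; split=> // [x xQ|]; last by lia.
by apply: lt; rewrite inE xQ orbT.
Qed.

Lemma layout_H Q a k e : layout Q a k.+2 e -> layout Q a.+1 k (a + k.+1).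
Proof. case=> sQ lt le; split=> // [x /lt|]; lia. Qed.

Lemma layout_R Q a k e : layout Q a k.+2 e -> layout Q a.+1 k e.
Proof. case=> sQ lt le; split=> // [x /lt|]; lia. Qed.

Lemma layout_U Q a k e : layout Q a k.+1 e -> layout (rcons Q a) a.+1 k e.
Proof.
case=> sQ lt le; split; last by lia.
- case: Q sQ lt {le} => //= q Q sQ lt; rewrite rcons_path sQ /=.
  by apply: lt; apply: mem_last.
- by move=> x; rewrite mem_rcons inE => /orP [/eqP ->|/lt]; lia.
Qed.

Lemma dom_D q Q a k e x : layout (q :: Q) a k.+1 e ->
  dom Q a k e x = [&& dom (q :: Q) a k.+1 e x, x != q & x != a + k].
Proof.
move=> lay; have hx := layout_head (x := x) lay; case: lay => _ lt le.
have qa : q < a by apply: lt; rewrite mem_head.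
have xa : x \in Q -> x < a by move=> xQ; apply: lt; rewrite inE xQ orbT.
by rewrite /dom !inE; case: (x \in Q) hx xa => [/(_ isT) + /(_ isT)|_ _]; lia.
Qed.

Lemma dom_H Q a k e x : layout Q a k.+2 e ->
  dom Q a.+1 k (a + k.+1) x = [&& dom Q a k.+2 e x, x != a & x != e].
Proof. case=> _ /(_ x); rewrite /dom; case: (x \in Q) => [/(_ isT)|_]; lia. Qed.

Lemma dom_R Q a k e x : layout Q a k.+2 e ->
  dom Q a.+1 k e x = [&& dom Q a k.+2 e x, x != a & x != a + k.+1].
Proof. case=> _ /(_ x); rewrite /dom; case: (x \in Q) => [/(_ isT)|_]; lia. Qed.

Lemma dom_U Q a k e : dom (rcons Q a) a.+1 k e =1 dom Q a k.+1 e.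
Proof. by move=> x; rewrite /dom mem_rcons inE; case: (x \in Q); lia. Qed.

Lemma iota_rcons a k : iota a k.+1 = rcons (iota a k) (a + k).
Proof. by rewrite -addn1 iotaD cats1. Qed.

Lemma map_iota_rcons (L : nat -> letter) a v x : map L (iota a (size (rcons v x))) = rcons v x ->
  map L (iota a (size v)) = v /\ L (a + size v) = x.
Proof. by rewrite size_rcons iota_rcons map_rcons => /rcons_inj [-> ->]. Qed.

(* The discarded hypotheses make [lia] about ten times slower. *)
Ltac arith := intros; repeat match goal with
  | h : ?P |- _ =>
    lazymatch P with
    | is_true (leq _ _) => fail
    | is_true (andb _ _) => fail
    | is_true (negb _) => fail
    | @eq _ _ _ => fail
    | or _ _ => fail
    | _ => clear h
    end
  end; lia.

(* Otherwise both ends of the ascent, or both their images, are labelled [U]. *)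
Lemma ascent_late X L f Q a k e x y : X =1 dom Q a k e -> layout Q a k e ->
  inv_on X f -> fits X L f -> (forall z, z \in Q -> L z = U) ->
  X x -> X y -> x < y -> f x < f y -> a <= y /\ a <= f y.
Proof.
move=> XE [_ _ le] iX [fL fd] LQ Xx Xy xy fxy.
have inQ z : X z -> z < a -> L z = U.
  by rewrite XE => /domP [/LQ|?|?] //; arith.
have [Xfx _] := iX _ Xx; have [Xfy _] := iX _ Xy.
have hU : L x = U -> L y = U -> False.
  by move=> Lx Ly; have := fd _ _ Xx Xy xy; rewrite Lx Ly => /(_ erefl); arith.
have [ya|ya] := ltnP y a; first by case: hU; apply: inQ => //; arith.
have [fya|//] := ltnP (f y) a.
by case: hU; rewrite -fL //; apply: inQ => //; arith.
Qed.

(** * From a path to an avoiding involution, and back by decoding *)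

(** The first element of [Q] is labelled [U], hence so is its image; thus the down-step test of
    [decode] fails when the last unread letter is not [U]. *)
Lemma fits_head_neq L f Q a k e y : fits (dom Q a k e) L f -> (forall z, z \in Q -> L z = U) ->
  L y != U -> (Q != [::]) && (f (head 0 Q) == y) = false.
Proof.
case: Q => //= q Q [fL _] LQ; apply: contraNF => /eqP <-; rewrite fL ?LQ ?mem_head //.
by apply/domP; apply: Or31; rewrite mem_head.
Qed.

(** Induction on [mid]. For every move but an up-step, [fits_extreme] identifies a matched pair, and
    the induction hypothesis applies to the other positions. An up-step only transfers [a] to [Q]
    and leaves the set of positions unchanged. *)
Lemma mid_decode_avoid t p v : mid t p v -> forall f L Q a e, size Q = t ->
  layout Q a (size v) e -> labels L Q a e v ->
  inv_on (dom Q a (size v) e) f -> fits (dom Q a (size v) e) L f ->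
  decode f (size v) Q a e = p /\ avoid_on (dom Q a (size v) e) f.
Proof.
(* By [ascent_late] the last three positions of a pattern are at least [a], but with [k <= 1] at
   most two such positions exist. *)
have small f L Q a k e : k <= 1 -> layout Q a k e -> (forall z, z \in Q -> L z = U) ->
    inv_on (dom Q a k e) f -> fits (dom Q a k e) L f -> avoid_on (dom Q a k e) f.
  move=> k1 lay LQ iX fX x1 x2 x3 x4 X1 X2 X3 X4 x12 x23 x34 f12 f23 f24.
  have [ax2 _] := ascent_late (fun _ => erefl) lay iX fX LQ X1 X2 x12 f12.
  case: lay => _ lt le.
  move: X2 X3 X4 => /domP [/lt h2|h2|h2] /domP [/lt h3|h3|h3] /domP [/lt h4|h4|h4]; arith.
elim=> {t p v}.
- move=> t f L Q a e sQ lay [LQ _ _] iX fX; split=> //; exact: small LQ iX fX.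
- move=> t f L Q a e sQ lay [LQ [La] Le] iX fX; split; last exact: small LQ iX fX.
  rewrite /= addn0; case: lay => _ lt le.
  have [fa fe] : f a = e /\ f e = a.
    apply: (fits_extreme iX fX); rewrite ?La ?Le //.
    + by apply/domP; constructor 2 => /=; arith.
    + by apply/domP; constructor 3.
    + by move=> x /domP [/LQ ->|/= h|h] // _; simpl in *; arith.
  by rewrite (fits_head_neq fX LQ) ?La // fa eqxx.
- move=> t f L Q a e sQ lay [LQ [La] Le] iX fX; split; last exact: small LQ iX fX.
  have [_ lt le] := lay.
  have Xa : dom Q a 1 e a by apply/domP; apply: Or32; arith.
  have [fa _] : f a = a /\ f a = a.
    apply: (fits_extreme iX fX) => // x /domP [/LQ ->|/= ?|->]; rewrite ?La ?Le //; arith.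
  have /negbTE ae : a != e by rewrite /= in le; arith.
  by rewrite /= addn0 (fits_head_neq fX LQ) ?La // fa eqxx ae.
- move=> t p v m IH f L [//|q Q] a e [sQ]; rewrite size_rcons => lay [LQ Lv Le] iX fX.
  have [_ lt le] := lay; have lay' := layout_D lay.
  have [Lv' Ly] := map_iota_rcons Lv.
  set y := a + size v in Ly; set X := dom _ _ _ _ in iX fX *.
  have Xq : X q by apply/domP; apply: Or31; rewrite mem_head.
  have Xy : X y by apply/domP; apply: Or32; arith.
  have qX x : X x -> q <= x.
    move=> /domP [|?|?]; last 2 first.
    + by have := lt q (mem_head _ _); arith.
    + by have := lt q (mem_head _ _); arith.
    by rewrite inE => /orP [/eqP ->|/(layout_head lay)] //; arith.
  have Xle x : X x -> x <= y \/ x = e.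
    by move=> /domP [/lt|?|?]; arith.
  have [fq fy] : f q = y /\ f y = q.
    apply: (fits_extreme iX fX); rewrite ?Ly ?LQ ?mem_head // => x Xx Lx.
    by have := qX _ Xx; case: (Xle _ Xx) Lx => [|->]; rewrite ?Le //; arith.
  have YX x := dom_D x lay.
  have iY := inv_on_sub iX fq fy YX.
  have fY : fits (dom Q a (size v) e) L f.
    by apply: fits_sub fX => x; rewrite YX => /and3P [].
  have [|dec av] := IH f L Q a e sQ lay' _ iY fY.
    by split=> // x xQ; apply: LQ; rewrite inE xQ orbT.
  split; first by rewrite /= fq eqxx /= dec.
  (* The pair [q], [y] takes no part in a pattern. The value [y] at the first position [q] has only
     [e] above it; the value [q] at [y] is the least one, and only the position [e] comes later. *)
  move=> x1 x2 x3 x4 X1 X2 X3 X4 x12 x23 x34 f12 f23 f24.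
  have [Xf2 _] := iX _ X2; have [Xf3 _] := iX _ X3.
  have x2y : x2 <= y by case: (Xle _ X2) => // E; case: (Xle _ X3); arith.
  have f2y : f x2 <= y by case: (Xle _ Xf2) => // E; case: (Xle _ Xf3); arith.
  have qf1 : q <= f x1 by case: (iX _ X1) => /qX.
  have q1 := qX _ X1.
  have nq x : f x != y -> x != q by apply: contra_neq => ->.
  have ny x : f x != q -> x != y by apply: contra_neq => ->.
  apply: (av x1 x2 x3 x4) => //; rewrite YX; apply/and3P; split=> //.
  + by apply: nq; arith.
  + arith.
  + arith.
  + by apply: ny; arith.
  + arith.
  + by apply: ny; arith.
  + arith.
  + by apply: ny; arith.
- move=> t p v m IH f L Q a e sQ; rewrite /= size_rcons => lay [LQ Lv Le] iX fX.
  have [_ lt le] := lay; have lay' := layout_H lay.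
  case: Lv => La Lv; have [Lv' Ly] := map_iota_rcons Lv.
  rewrite addSnnS in Ly.
  set y := a + (size v).+1 in Ly lay' *; set X := dom _ _ _ _ in iX fX *.
  have Xa : X a by apply/domP; apply: Or32; arith.
  have Xe : X e by apply/domP; apply: Or33.
  have Xy : X y by apply/domP; apply: Or32; arith.
  have Xle x : X x -> x <= e by move=> /domP [/lt|?|?]; arith.
  have [fa fe] : f a = e /\ f e = a.
    apply: (fits_extreme iX fX); rewrite ?La ?Le // => x Xx Lx; rewrite Xle // andbT.
    by move: Xx Lx => /domP [/LQ ->|?|?] //; arith.
  have YX x := dom_H x lay.
  have iY := inv_on_sub iX fa fe YX.
  have fY : fits (dom Q a.+1 (size v) y) L f.
    by apply: fits_sub fX => x; rewrite YX => /and3P [].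
  have [//|dec av] := IH f L Q a.+1 y sQ lay' _ iY fY.
  split.
    by rewrite (fits_head_neq fX LQ) ?Ly // fa eqxx dec.
  (* The second entry has position and value at least [a]. So [a], which carries the greatest value
     [e], cannot be one of the first two positions nor a later one; and [e], the last position,
     carries [a], too small for the fourth entry. *)
  move=> x1 x2 x3 x4 X1 X2 X3 X4 x12 x23 x34 f12 f23 f24.
  have [l2 m2] := ascent_late (fun _ => erefl) lay iX fX LQ X1 X2 x12 f12.
  have ef3 : f x3 <= e by case: (iX _ X3) => /Xle.
  have e4 := Xle _ X4.
  have na x : f x != e -> x != a by apply: contra_neq => ->.
  have ne x : f x != a -> x != e by apply: contra_neq => ->.
  apply: (av x1 x2 x3 x4) => //; rewrite YX; apply/and3P; split=> //.
  + by apply: na; arith.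
  + arith.
  + by apply: na; arith.
  + arith.
  + arith.
  + arith.
  + arith.
  + by apply: ne; arith.
- move=> t p v m IH f L Q a e sQ; rewrite /= size_rcons => lay [LQ Lv Le] iX fX.
  have [_ lt le] := lay; have lay' := layout_R lay.
  case: Lv => La Lv; have [Lv' Ly] := map_iota_rcons Lv.
  rewrite addSnnS in Ly.
  set y := a + (size v).+1 in Ly *; set X := dom _ _ _ _ in iX fX *.
  have Xa : X a by apply/domP; apply: Or32; arith.
  have Xy : X y by apply/domP; apply: Or32; arith.
  have Xle x : X x -> x <= y \/ x = e by move=> /domP [/lt|?|?]; arith.
  have [fa fy] : f a = y /\ f y = a.
    apply: (fits_extreme iX fX); rewrite ?La ?Ly // => x Xx Lx.
    by move: Xx Lx => /domP [/LQ ->|?|->]; rewrite ?Le //; arith.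
  have YX x := dom_R x lay.
  have iY := inv_on_sub iX fa fy YX.
  have fY : fits (dom Q a.+1 (size v) e) L f.
    by apply: fits_sub fX => x; rewrite YX => /and3P [].
  have [//|dec av] := IH f L Q a.+1 e sQ lay' _ iY fY.
  have /negbTE ye : y != e by arith.
  split.
    by rewrite (fits_head_neq fX LQ) ?Ly // fa ye eqxx dec.
  (* Only [e] exceeds [y], while the second entry has two later positions and two larger values;
     hence its position and value are below [y]. The value [y] at [a] is then too large for the
     first two entries, and the value [a] at [y] too small for the last two. *)
  move=> x1 x2 x3 x4 X1 X2 X3 X4 x12 x23 x34 f12 f23 f24.
  have [l2 m2] := ascent_late (fun _ => erefl) lay iX fX LQ X1 X2 x12 f12.
  have [Xf3 _] := iX _ X3; have [Xf4 _] := iX _ X4.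
  have x2y : x2 < y by case: (Xle _ X3) => ?; case: (Xle _ X4); arith.
  have f2y : f x2 < y.
    case: (Xle _ Xf3) => [|E3]; first arith; case: (Xle _ Xf4) => [|E4]; first arith.
    by have := inv_on_inj iX X3 X4; rewrite E3 E4 => /(_ erefl); arith.
  have na x : f x != y -> x != a by apply: contra_neq => ->.
  have ny x : f x != a -> x != y by apply: contra_neq => ->.
  apply: (av x1 x2 x3 x4) => //; rewrite YX; apply/and3P; split=> //.
  + by apply: na; arith.
  + arith.
  + by apply: na; arith.
  + arith.
  + arith.
  + by apply: ny; arith.
  + arith.
  + by apply: ny; arith.
move=> t p v m IH hp f L Q a e sQ lay [LQ [La Lv] Le] iX fX.
have [dec av] : decode f (size v) (rcons Q a) a.+1 e = p /\
  avoid_on (dom (rcons Q a) a.+1 (size v) e) f.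
  apply: (IH f L); first by rewrite size_rcons sQ.
  - exact: layout_U lay.
  - by split=> // x; rewrite mem_rcons inE => /orP [/eqP ->|/LQ].
  - by apply: inv_on_eq iX => x; rewrite dom_U.
  - by apply: fits_sub fX => x; rewrite dom_U.
split; last by apply: avoid_sub av => x; rewrite dom_U.
(* The last unread letter is not [U], so the down-step test fails; and [f a], labelled [U], is
   neither that position nor [e]. *)
have lv := mid_last m hp.
have [_ lt le] := lay; have [fL _] := fX.
have Ly : L (a + size v) != U.
  case: (lastP v) lv Lv {m IH lay le iX fX fL dec av} => // v1 z; rewrite last_rcons => zU Lv.
  by have [_ Ly] := map_iota_rcons Lv; rewrite size_rcons -addSnnS Ly.
have Xa : dom Q a (size v).+1 e a by apply/domP; apply: Or32; arith.
have noU z : L z != U -> (f a == z) = false.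
  by apply: contraNF => /eqP <-; rewrite fL // La.
by rewrite /= (fits_head_neq fX LQ) // (noU e) ?Le // noU // dec.
Qed.

(** * From an avoiding involution to a path *)

Lemma fits_decreasing (Q : seq nat) L f :
  inv_on (fun x => x \in Q) f -> (forall x, x \in Q -> L x = U) ->
  (forall x y, x \in Q -> y \in Q -> x < y -> f y < f x) -> fits (fun x => x \in Q) L f.
Proof.
move=> iQ LQ dQ; split=> [x xQ|x y xQ yQ xy _]; last exact: dQ.
by rewrite !LQ //; case: (iQ _ xQ).
Qed.

Definition relabel (L : nat -> letter) (a b : nat) (l : letter) : nat -> letter :=
  fun x => if (x == a) || (x == b) then l else L x.

Lemma relabel_id L a b l x : x != a -> x != b -> relabel L a b l x = L x.
Proof. by rewrite /relabel => /negbTE -> /negbTE ->. Qed.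

Lemma fits_relabel (X Y : pred nat) L f a b l : inv_on Y f -> f a = b -> f b = a ->
  (forall x, Y x = [&& X x, x != a & x != b]) -> (forall x, Y x -> L x = l -> a < x < b) ->
  a <= b -> fits Y L f -> fits X (relabel L a b l) f.
Proof.
move=> iY fa fb YX btw ab [fL1 fL2].
have LL x : Y x -> relabel L a b l x = L x.
  by rewrite YX => /and3P [_]; apply: relabel_id.
have La : relabel L a b l a = l by rewrite /relabel eqxx.
apply: (fits_add iY fa fb); rewrite ?La //.
- by rewrite /relabel eqxx orbT.
- by move=> x Xx; rewrite YX Xx /=; case: (x == a); case: (x == b).
- by move=> x Yx; rewrite LL //; apply: btw.
split=> [x Yx|x z Yx Yz xz].
  by rewrite !LL ?fL1 //; case: (iY _ Yx).
by rewrite !LL //; apply: fL2.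
Qed.

Lemma map_relabel L a b l s : a \notin s -> b \notin s -> map (relabel L a b l) s = map L s.
Proof.
move=> sa sb; apply/eq_in_map => x xs; apply: relabel_id; apply/eqP => E.
  by rewrite -E xs in sa.
by rewrite -E xs in sb.
Qed.

(** Strong induction on [k], following the tests of [decode]: the recursive call handles the smaller
    stage, and [v] and the labels are then extended outwards. The last clause of the conclusion
    serves to prove the side condition of [mid_U]; the default makes it cover the empty path as
    well. *)
Lemma avoid_mid k : forall f Q a e, layout Q a k e -> inv_on (dom Q a k e) f ->
  avoid_on (dom Q a k e) f -> (forall x y, x \in Q -> y \in Q -> x < y -> f y < f x) ->
  a <= f e ->
  exists p v L, [/\ mid (size Q) p v, size v = k, labels L Q a e v, fits (dom Q a k e) L f &
    head D p = D -> k = 0 \/ (Q != [::]) && (f (head 0 Q) == a + k.-1)].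
Proof.
have [m] := ubnP k; elim: m k => // m IH k km f Q a e lay iX av dQ fe.
have [_ lt le] := lay.
have Xe : dom Q a k e e by apply/domP; apply: Or33.
have [Xfe ffe] := iX _ Xe.
have inQ x : x \in Q -> dom Q a k e x by move=> xQ; apply/domP; apply: Or31.
case: k km lay iX av le Xe Xfe inQ => [_|k km] lay iX av le Xe Xfe inQ.
  (* With no unread position, [e] is the only position that is at least [a]. *)
  have fee : f e = e by move: Xfe => /domP [/lt|?|?]; arith.
  have iQ : inv_on (fun x => x \in Q) f.
    move=> x xQ; have [Xfx ffx] := iX _ (inQ _ xQ); split=> //.
    move: Xfx => /domP [//|?|fxe]; first arith.
    by have := lt _ xQ; rewrite -ffx fxe fee; arith.
  exists [::], [::], (fun x => if x < a then U else H).
  have LQ x : x \in Q -> (if x < a then U else H) = U by move/lt ->.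
  have Le : (if e < a then U else H) = H by case: ifP => //; arith.
  split; [exact: mid_nil | by [] | by split | | by left].
  apply: (fits_add iQ fee fee) => //; last exact: fits_decreasing.
    by move=> x /domP [xQ|?|->]; rewrite ?eqxx ?orbT //=; [rewrite xQ | arith].
  by move=> x /LQ ->; rewrite Le.
set X := dom _ _ _ _ in iX av Xe Xfe inQ *.
set y := a + k.
have Xa : X a by apply/domP; apply: Or32; arith.
have Xy : X y by apply/domP; apply: Or32; arith.
have [Xfa ffa] := iX _ Xa.
have [Xfy ffy] := iX _ Xy.
have Xle x : X x -> x <= y \/ x = e by move=> /domP [/lt|?|?]; arith.
have ey : y < e by arith.
have [/andP [Q0 /eqP fq]|dtest] := boolP ((Q != [::]) && (f (head 0 Q) == y)).
  case: Q Q0 fq lay lt @X iX av Xe Xfe inQ dQ Xa Xy Xfa Xfy Xle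
    => [//|q Q] _ fq lay lt X iX av Xe Xfe inQ dQ Xa Xy Xfa Xfy Xle.
  rewrite /= in fq.
  have Xq : X q by apply: inQ; rewrite mem_head.
  have fy : f y = q by rewrite -fq; case: (iX _ Xq).
  have YX x := dom_D x lay.
  have iY := inv_on_sub iX fq fy YX.
  have avY : avoid_on (dom Q a k e) f.
    by apply: avoid_sub av => x; rewrite YX => /and3P [].
  have [|p [v [L [mp sv [LQ Lv Le] fL _]]]] := IH k km f Q a e (layout_D lay) iY avY _ fe.
    by move=> x z xQ zQ; apply: dQ; rewrite inE ?xQ ?zQ orbT.
  exists (D :: rcons p U), (rcons v U), (relabel L q y U).
  have qa : q < a by apply: lt; rewrite mem_head.
  split; [exact: mid_D | by rewrite size_rcons sv | split | | by right].
  - by move=> x; rewrite inE /relabel; case: eqP => //= _ xQ; rewrite LQ // if_same.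
  - rewrite size_rcons sv iota_rcons map_rcons -/y [relabel _ _ _ _ y]/relabel eqxx orbT.
    by rewrite map_relabel ?mem_iota; [rewrite -sv Lv | arith | arith].
  - by rewrite relabel_id ?Le //; arith.
  apply: (fits_relabel iY fq fy YX) => //; last by arith.
  move=> x /domP [xQ|?|->]; [|arith|by rewrite Le].
  by have := layout_head lay xQ; have := lt x; rewrite inE xQ orbT => /(_ isT); arith.
(* Otherwise [f (head 0 Q)] would exceed [y], hence equal [e], against [a <= f e]. *)
have CQ x : x \in Q -> f x != y.
  move=> xQ; apply/eqP => fxy.
  have [Q0 hQ hx] : [/\ Q != [::], head 0 Q \in Q & head 0 Q <= x].
    case: (Q) lay xQ => // q Q' lay'; rewrite mem_head inE /= => /orP [/eqP -> //|].
    by move/(layout_head lay') => /ltnW.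
  have [Xq ffq] := iX _ (inQ _ hQ).
  have qx : head 0 Q < x.
    rewrite ltn_neqAle hx andbT; apply: contra dtest => /eqP E.
    by rewrite Q0 E fxy eqxx.
  have := dQ _ _ hQ xQ qx; rewrite fxy => lty.
  have fqe : f (head 0 Q) = e by case: (Xle _ Xq) => //; arith.
  by move: ffq fe (lt _ hQ); rewrite fqe => ->; arith.
have [fae|fae] := eqVneq (f a) e.
  have fea : f e = a by rewrite -fae.
  case: k km lay @X iX av le Xe Xfe inQ @y dtest Xa Xy Xfa Xfy Xle ey CQ ffy
    => [|k] km lay X iX av le Xe Xfe inQ y dtest Xa Xy Xfa Xfy Xle ey CQ ffy.
    exists [:: H], [:: H], (fun x => if x < a then U else H).
    have LQ x : x \in Q -> (if x < a then U else H) = U by move/lt ->.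
    have Lge x : a <= x -> (if x < a then U else H) = H by case: ltnP.
    have iQ : inv_on (fun x => x \in Q) f.
      move=> x xQ; have [Xfx ffx] := iX _ (inQ _ xQ); split=> //.
      have xa := lt _ xQ; move: Xfx => /domP [//|?|fxe].
        by have E : f x = a by [arith]; move: ffx; rewrite E fae; arith.
      by move: ffx; rewrite fxe fea; arith.
    split; [exact: mid_h | by [] | split | | by []] => //.
    - by rewrite /= Lge.
    - by rewrite Lge //; arith.
    apply: (fits_add iQ fae fea); [ | | | arith | exact: fits_decreasing].
    - by rewrite !Lge //; arith.
    - by move=> x /domP [->|?|->]; rewrite ?eqxx ?orbT //; arith.
    by move=> x /LQ ->; rewrite Lge.
  have YX x := dom_H x lay; rewrite -/y in YX.
  have iY := inv_on_sub iX fae fea YX.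
  have avY : avoid_on (dom Q a.+1 k y) f.
    by apply: avoid_sub av => x; rewrite YX => /and3P [].
  (* Since [y] becomes the new [e], the invariant on its image must be re-established: [f y] is not
     in [Q] by [CQ], and it is not [a], which is matched with [e]. *)
  have fyQ : f y \notin Q by apply/negP => /CQ; rewrite ffy eqxx.
  have fy_a : a < f y.
    have fya : f y != a by apply/eqP => E; move: ffy; rewrite E fae; arith.
    by move: Xfy => /domP [|?|?]; [rewrite (negbTE fyQ) | arith | arith].
  have [|p [v [L [mp sv [LQ Lv Le] fL _]]]] := IH k _ f Q a.+1 y (layout_H lay) iY avY dQ fy_a.
    by arith.
  exists (H :: rcons p H), (H :: rcons v H), (relabel L a e H).
  split; [exact: mid_H | by rewrite /= size_rcons sv | split | | by []].
  - by move=> x xQ; rewrite relabel_id ?LQ //; have := lt _ xQ; arith.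
  - rewrite /= size_rcons sv iota_rcons map_rcons addSnnS -/y [relabel _ _ _ _ a]/relabel eqxx.
    rewrite map_relabel ?mem_iota; try arith.
    by rewrite -sv Lv relabel_id ?Le //; arith.
  - by rewrite /relabel eqxx orbT.
  apply: (fits_relabel iY fae fea YX) => //; last by arith.
  by move=> x /domP [/LQ ->|?|?] // _; arith.
have [fay|fay] := eqVneq (f a) y.
  have fya : f y = a by rewrite -fay.
  case: k km lay @X iX av le Xe Xfe inQ @y dtest Xa Xy Xfa Xfy Xle ey CQ ffy fay fya
    => [|k] km lay X iX av le Xe Xfe inQ y dtest Xa Xy Xfa Xfy Xle ey CQ ffy fay fya.
    have ya : y = a by rewrite /y addn0.
    rewrite ya in fay.
    have fee : f e = e.
      move: Xfe => /domP [/lt|h|//]; first arith.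
      by have E : f e = a by [arith]; move: ffe; rewrite E fay; arith.
    pose L x := if x < a then U else if x == a then R else H.
    have LQ x : x \in Q -> L x = U by move/lt; rewrite /L => ->.
    have La : L a = R by rewrite /L ltnn eqxx.
    have Le : L e = H by rewrite /L; case: ltnP; [arith | case: eqP => //; arith].
    exists [:: U; D], [:: R], L.
    split; [exact: mid_r | by [] | by split=> //=; rewrite La | | by []].
    have iQ : inv_on (fun x => x \in Q) f.
      move=> x xQ; have [Xfx ffx] := iX _ (inQ _ xQ); split=> //.
      have xa := lt _ xQ; move: Xfx => /domP [//|?|fxe].
        by have E : f x = a by [arith]; move: ffx; rewrite E fay; arith.
      by move: ffx; rewrite fxe fee; arith.
    have iQe : inv_on (fun x => (x \in Q) || (x == e)) f.
      by move=> x /orP [/iQ [-> ->]|/eqP ->] //; rewrite fee eqxx orbT.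
    apply: (fits_add iQe fay fay) => //.
    - by move=> x /domP [->|?|->]; rewrite ?eqxx ?orbT //; arith.
    - by move=> x /orP [/LQ ->|/eqP ->]; rewrite La // Le.
    apply: (fits_add iQ fee fee) => //; last exact: fits_decreasing.
    - by move=> x /orP [->|->]; rewrite ?orbT.
    by move=> x /LQ ->; rewrite Le.
  have YX x := dom_R x lay; rewrite -/y in YX.
  have iY := inv_on_sub iX fay fya YX.
  have avY : avoid_on (dom Q a.+1 k e) f.
    by apply: avoid_sub av => x; rewrite YX => /and3P [].
  have fe_a : a < f e.
    have fea : f e != a by apply/eqP => E; move: ffe; rewrite E fay; arith.
    by arith.
  have [|p [v [L [mp sv [LQ Lv Le] fL _]]]] := IH k _ f Q a.+1 e (layout_R lay) iY avY dQ fe_a.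
    by arith.
  exists (U :: D :: rcons (rcons p U) D), (R :: rcons v R), (relabel L a y R).
  split; [exact: mid_R | by rewrite /= size_rcons sv | split | | by []].
  - by move=> x xQ; rewrite relabel_id ?LQ //; have := lt _ xQ; arith.
  - rewrite /= size_rcons sv iota_rcons map_rcons addSnnS -/y [relabel _ _ _ _ a]/relabel eqxx.
    rewrite map_relabel ?mem_iota; try arith.
    by rewrite -sv Lv /relabel eqxx orbT.
  - by rewrite relabel_id ?Le //; arith.
  apply: (fits_relabel iY fay fya YX) => //; last by arith.
  by move=> x /domP [/LQ ->|?|->]; rewrite ?Le //; arith.
have fea : a < f e.
  have : f e != a by apply: contra_neq fae => E; rewrite -[in RHS]ffe E.
  by arith.
have fy_a : a < f y.
  have : f y != a by apply: contra_neq fay => E; rewrite -[in RHS]ffy E.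
  by move: Xfy => /domP [/CQ|?|?]; [rewrite ffy eqxx | arith | arith].
have fa_y : f a < y by case: (Xle _ Xfa) => [|/eqP]; [arith | rewrite (negbTE fae)].
(* If [k] were 0, then [y] would be [a] and [f a < a] would lie in [Q], against [CQ]. *)
have k_gt0 : 0 < k.
  rewrite lt0n; apply/eqP => k0; have ya : y = a by rewrite /y k0 addn0.
  by move: Xfa fa_y; rewrite ya => /domP [/CQ|?|?]; [rewrite ffa ya eqxx|arith|arith].
(* Otherwise [x], [a], [f y], [f e] are the positions of a 1234 or 1243. *)
have dQa x : x \in Q -> f a < f x.
  move=> xQ; have xa := lt _ xQ; have Xx := inQ _ xQ.
  have [lt'|//|E] := ltngtP (f x) (f a); last first.
    by have := inv_on_inj iX Xx Xa E; arith.
  have [yE|eY|E] := ltngtP (f y) (f e).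
  - by case: (av x a (f y) (f e)); rewrite ?ffy ?ffe //; arith.
  - by case: (av x a (f e) (f y)); rewrite ?ffy ?ffe //; arith.
  by have := inv_on_inj iX Xy Xe E; arith.
have iY : inv_on (dom (rcons Q a) a.+1 k e) f by apply: inv_on_eq iX => x; rewrite dom_U.
have avY : avoid_on (dom (rcons Q a) a.+1 k e) f by apply: avoid_sub av => x; rewrite dom_U.
have [x z|p [v [L [mp sv [LQ Lv Le] fL hp]]]] :=
  IH k km f (rcons Q a) a.+1 e (layout_U lay) iY avY _ fea.
  rewrite !mem_rcons !inE => /orP [/eqP ->|xQ] /orP [/eqP ->|zQ]; try arith.
  - by have := lt _ zQ; arith.
  - by rewrite dQa.
  by apply: dQ.
rewrite size_rcons in mp.
have La : L a = U by apply: LQ; rewrite mem_rcons mem_head.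
exists (U :: rcons p D), (U :: v), L; split=> //.
(* If [p] began with a down-step, the head of [rcons Q a] would be sent to [y]. That head is [a]
   when [Q] is empty, against [fay], and the head of [Q] otherwise, against [dtest]. *)
- apply: mid_U => //; apply/eqP => /hp [k0|]; first by rewrite k0 in k_gt0.
  case/andP=> _ /eqP.
  rewrite addSnnS prednK // -/y.
  by case: (Q) dtest => [_|q Q'] /= => [|/negbTE +] E; [move: fay; rewrite E eqxx|rewrite E eqxx].
- by rewrite /= sv.
- by split=> // [x xQ|]; [apply: LQ; rewrite mem_rcons inE xQ orbT | rewrite /= La Lv].
by apply: fits_sub fL => x; rewrite dom_U.
Qed.

(** * One-line notation *)

(** Positions count from 1. Index 0 would be read as position 1, which is why [upto] excludes it. *)
Definition at_pos (s : seq nat) (i : nat) : nat := nth 0 s i.-1.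
Definition letter_at (w : seq letter) (i : nat) : letter := nth H w i.-1.
Definition upto (m : nat) : pred nat := fun i => 0 < i <= m.

Lemma mem_Aset w x i : (i \in Aset w x) = upto (size w) i && (letter_at w i == x).
Proof. by rewrite mem_filter mem_iota andbC add1n ltnS. Qed.

Lemma sorted_Aset w x : sorted ltn (Aset w x).
Proof. by apply: sorted_filter; [exact: ltn_trans | exact: iota_ltn_sorted]. Qed.

Lemma size_phi_word w : size (phi_word w) = size w.
Proof. by rewrite size_map size_iota. Qed.

Lemma phi_word_at w i : upto (size w) i ->
  at_pos (phi_word w) i = nth 0 (rev (Aset w (letter_at w i))) (index i (Aset w (letter_at w i))).
Proof.
case: i => // i /andP [_ hi].
by rewrite /at_pos (nth_map 0) ?size_iota // nth_iota // add1n.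
Qed.

(** On the increasing list of a class, [phi_word] sends index [j] to [size - j.+1], which is an
    involution and decreasing. *)
Lemma phi_word_fits w :
  inv_on (upto (size w)) (at_pos (phi_word w)) /\
  fits (upto (size w)) (letter_at w) (at_pos (phi_word w)).
Proof.
pose A i := Aset w (letter_at w i).
have iA i : upto (size w) i -> i \in A i by rewrite mem_Aset eqxx andbT.
have uA i : uniq (A i) by apply: sorted_uniq (sorted_Aset _ _); [exact: ltn_trans | exact: ltnn].
have fE i : upto (size w) i ->
    at_pos (phi_word w) i = nth 0 (A i) (size (A i) - (index i (A i)).+1).
  by move=> Xi; rewrite phi_word_at // nth_rev // index_mem iA.
have fA i : upto (size w) i -> at_pos (phi_word w) i \in A i.
  move=> Xi; rewrite fE // mem_nth // ltn_subrL /=.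
  by case: (A i) (iA i Xi).
have revK j k : j < k -> k - (k - j.+1).+1 = j by lia.
have rev_lt j k : j < k -> k - j.+1 < k by lia.
have AA i j : letter_at w i = letter_at w j -> A i = A j by rewrite /A => ->.
have fX i : upto (size w) i -> upto (size w) (at_pos (phi_word w) i) /\
    letter_at w (at_pos (phi_word w) i) = letter_at w i.
  by move=> Xi; have := fA i Xi; rewrite mem_Aset => /andP [? /eqP].
split; last split.
- move=> i Xi; have [Xfi Lfi] := fX i Xi; split=> //.
  have := iA i Xi; rewrite -index_mem => hi.
  rewrite fE // (AA _ _ Lfi) fE // index_uniq ?rev_lt // revK //.
  by rewrite nth_index // iA.
- by move=> i /fX [].
move=> x y Xx Xy xy Lxy.
have := iA x Xx; have := iA y Xy; rewrite -!index_mem (AA _ _ Lxy) => hy hx.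
have mono := sorted_ltn_nth ltn_trans 0 (sorted_Aset w (letter_at w y)).
rewrite !fE // (AA _ _ Lxy); apply: (mono); rewrite ?inE -/(A y) ?rev_lt //.
rewrite ltn_sub2lE // ltnS.
rewrite ltnNge leq_eqVlt; apply/negP => /orP [/eqP E|lt_yx].
  have : nth 0 (A y) (index y (A y)) = nth 0 (A y) (index x (A y)) by rewrite E.
  by rewrite !nth_index -?index_mem //; lia.
have := mono _ _ hy hx lt_yx.
by rewrite !nth_index -?index_mem //; lia.
Qed.

(** On each class [A], the images under [s] form a decreasing list with the same elements as [A], so
    this list is [rev A]. *)
Lemma phi_word_unique s w : size s = size w ->
  inv_on (upto (size w)) (at_pos s) -> fits (upto (size w)) (letter_at w) (at_pos s) ->
  phi_word w = s.
Proof.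
move=> sz iX [fL fd].
apply: (@eq_from_nth _ 0); rewrite size_phi_word // => i hi.
have Xi : upto (size w) i.+1 by [].
rewrite -[LHS]/(at_pos (phi_word w) i.+1) -[RHS]/(at_pos s i.+1) phi_word_at //.
set A := Aset w _.
have iA : i.+1 \in A by rewrite mem_Aset Xi eqxx.
have inA x : x \in A -> upto (size w) x /\ letter_at w x = letter_at w i.+1.
  by rewrite mem_Aset => /andP [? /eqP].
suff -> : rev A = map (at_pos s) A by rewrite (nth_map 0) ?index_mem // nth_index.
apply: (irr_sorted_eq (leT := gtn)).
- by move=> x y z; rewrite /gtn /=; lia.
- by move=> x; rewrite /gtn /= ltnn.
- by rewrite rev_sorted; apply: sorted_Aset.
- apply: (homo_sorted_in (P := [in A])) (sorted_Aset _ _); last exact/allP.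
  move=> x y xA yA xy; have [Xx Lx] := inA _ xA; have [Xy Ly] := inA _ yA.
  by apply: fd => //; rewrite Lx Ly.
move=> x; rewrite mem_rev; apply/idP/mapP => [/inA [Xx Lx]|[z /inA [Xz Lz] ->]].
  have [Xfx ffx] := iX _ Xx; exists (at_pos s x) => //.
  by rewrite mem_Aset Xfx fL // Lx eqxx.
by rewrite mem_Aset fL // Lz eqxx andbT; case: (iX _ Xz).
Qed.

Lemma is_involutionP m s : reflect (size s = m /\ inv_on (upto m) (at_pos s)) (is_involution m s).
Proof.
have in_iota i : (i \in iota 1 m) = upto m i by rewrite mem_iota add1n ltnS.
apply: (iffP andP) => [[ps /allP as_]|[sz iX]].
  have sz : size s = m by rewrite (perm_size ps) size_iota.
  split=> // i Xi; split; last by apply/eqP/as_; rewrite in_iota.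
  by rewrite -in_iota -(perm_mem ps) mem_nth // sz; case: i Xi.
have us : uniq s.
  apply/(uniqP 0) => i j; rewrite !inE sz => hi hj E.
  by apply: succn_inj; apply: (inv_on_inj iX).
split; last by apply/allP => i; rewrite in_iota => /iX [_ /eqP].
apply: uniq_perm => //; first exact: iota_uniq.
have ss : {subset s <= iota 1 m}.
  by move=> x /(nthP 0) [i]; rewrite sz => hi <-; rewrite in_iota; case: (iX i.+1).
by case: (uniq_min_size us ss) => //; rewrite size_iota sz.
Qed.

Lemma containsP s pat : contains s pat <->
  exists u, [/\ sorted ltn u, all (fun i => i < size s) u, size u = size pat &
    forall i j, i < size pat -> j < size pat ->
    (nth 0 s (nth 0 u i) < nth 0 s (nth 0 u j)) = (nth 0 pat i < nth 0 pat j)].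
Proof.
split=> [[t [ts sz cmp]]|[u [su us sz cmp]]].
  case/subseqP: ts => b sb tE.
  have tE' : t = map (nth 0 s) (mask b (iota 0 (size s))).
    by rewrite map_mask -[X in X = _]/t tE -/(mkseq _ _) mkseq_nth.
  exists (mask b (iota 0 (size s))); split.
  - by apply: sorted_mask (iota_ltn_sorted _ _); apply: ltn_trans.
  - by apply/allP => i /mem_mask; rewrite mem_iota.
  - by rewrite -sz tE' size_map.
  move=> i j hi hj; rewrite -cmp // tE' !(nth_map 0) //;
  by move: sz; rewrite tE' size_map => ->.
exists (map (nth 0 s) u); split; rewrite ?size_map //.
  rewrite -{2}(mkseq_nth 0 s); apply: map_subseq.
  (* A strictly increasing list of indices equals the filter of all indices by membership in it,
     hence is a subsequence. *)
  rewrite (_ : u = [seq i <- iota 0 (size s) | i \in u]); first exact: filter_subseq.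
  apply: (irr_sorted_eq ltn_trans ltnn) => //.
    by apply: sorted_filter; [exact: ltn_trans | exact: iota_ltn_sorted].
  move=> i; rewrite mem_filter mem_iota add0n /=.
  by case iu: (i \in u); rewrite //= (allP us).
by move=> i j hi hj; rewrite -cmp // !(nth_map 0) ?sz.
Qed.

Lemma avoid_onP m s : size s = m -> inv_on (upto m) (at_pos s) ->
  avoid_on (upto m) (at_pos s) <-> avoids s [:: 1; 2; 3; 4] /\ avoids s [:: 1; 2; 4; 3].
Proof.
move=> sz iX; split=> [av|[av1 av2]].
  (* Both patterns are treated at once: all that matters is that the last two entries exceed 2. *)
  have low c d : 2 < c -> 2 < d -> avoids s [:: 1; 2; c; d].
    move=> c2 d2 /containsP [u [su us szu cmp]].
    case: u su us szu cmp => [|a1 [|a2 [|a3 [|a4 [|? ?]]]]] //= su us _ cmp.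
    move: su us; rewrite sz => /and4P [h12 h23 h34 _] /and5P [u1 u2 u3 u4 _].
    apply: (av a1.+1 a2.+1 a3.+1 a4.+1) => //.
    - by have := cmp 0 1 isT isT; rewrite /at_pos /= => ->.
    - by have := cmp 1 2 isT isT; rewrite /at_pos /= => ->.
    - by have := cmp 1 3 isT isT; rewrite /at_pos /= => ->.
  by split; apply: low.
move=> [|x1] [|x2] [|x3] [|x4] // X1 X2 X3 X4 x12 x23 x34 f12 f23 f24.
have sorted_u : sorted ltn [:: x1; x2; x3; x4].
  by rewrite /=; arith.
have all_u : all (fun i => i < size s) [:: x1; x2; x3; x4].
  by rewrite /= sz; move: X1 X2 X3 X4; rewrite /upto /=; lia.
rewrite /at_pos /= in f12 f23 f24.
(* The order of the last two values decides which of the two patterns occurs; equality contradicts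
   injectivity. *)
have [lt34|lt43|E] := ltngtP (nth 0 s x3) (nth 0 s x4).
- apply: av1; apply/containsP; exists [:: x1; x2; x3; x4]; split=> //.
  by move=> [|[|[|[|i]]]] [|[|[|[|j]]]] //= _ _; lia.
- apply: av2; apply/containsP; exists [:: x1; x2; x3; x4]; split=> //.
  by move=> [|[|[|[|i]]]] [|[|[|[|j]]]] //= _ _; lia.
by have := inv_on_inj iX X3 X4 E; lia.
Qed.

(** * The initial stage: [Q] is empty, the positions 1 to [n] are unread, and [e] is [n.+1], the
    appended [H] *)

Lemma dom_upto n : dom [::] 1 n n.+1 =1 upto n.+1.
Proof. by move=> x; rewrite /dom /upto /=; lia. Qed.

Lemma layout_upto n : layout [::] 1 n n.+1.
Proof. by split=> //; lia. Qed.

Lemma labels_upto v : labels (letter_at (rcons v H)) [::] 1 (size v).+1 v.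
Proof.
split=> //; last by rewrite /letter_at /= nth_rcons ltnn eqxx.
apply: (@eq_from_nth _ H); rewrite size_map size_iota // => i hi.
by rewrite (nth_map 0) ?size_iota // nth_iota // /letter_at /= nth_rcons hi.
Qed.

Lemma phi_mid p v : mid 0 p v -> [/\ size (phi p) = (size v).+1,
  inv_on (upto (size v).+1) (at_pos (phi p)), avoid_on (upto (size v).+1) (at_pos (phi p)) &
  decode (at_pos (phi p)) (size v) [::] 1 (size v).+1 = p].
Proof.
move=> m; rewrite /phi (pprime_mid m).
have := phi_word_fits (rcons v H); rewrite size_rcons => -[iX fX].
have [] := mid_decode_avoid m (f := at_pos (phi_word (rcons v H))) (L := letter_at (rcons v H))
  (Q := [::]) erefl (layout_upto _) (labels_upto v).
- by apply: inv_on_eq iX => x; rewrite dom_upto.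
- by apply: fits_sub fX => x; rewrite dom_upto.
move=> dec av; split=> //; first by rewrite size_phi_word size_rcons.
by apply: avoid_sub av => x; rewrite dom_upto.
Qed.

Theorem theorem2p1 (n : nat) :
  [/\ (forall p, Sh n p -> I_1234_1243 n.+1 (phi p)),
      (forall p q, Sh n p -> Sh n q -> phi p = phi q -> p = q) &
      (forall s, I_1234_1243 n.+1 s -> exists p, Sh n p /\ phi p = s)].
Proof.
split.
- move=> p /Sh_mid [v m <-]; have [sz iX av _] := phi_mid m.
  by have [av1 av2] := (avoid_onP sz iX).1 av; split=> //; apply/is_involutionP.
- move=> p q /Sh_mid [v mp sv] /Sh_mid [v' mq sv'] E.
  have [_ _ _ <-] := phi_mid mp; have [_ _ _ <-] := phi_mid mq.
  by rewrite E sv sv'.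
move=> s [/is_involutionP [sz iX] av1 av2].
have av := (avoid_onP sz iX).2 (conj av1 av2).
have [||||p [v [L [m sv [_ Lv Le] fL _]]]] := @avoid_mid n (at_pos s) [::] 1 n.+1 (layout_upto n).
- by apply: inv_on_eq iX => x; rewrite dom_upto.
- by apply: avoid_sub av => x; rewrite dom_upto.
- by [].
- by have [] := iX n.+1; rewrite /upto ?ltnSn // => /andP [].
exists p; split; first by rewrite -sv; apply: mid_Sh m.
(* It remains to see that [s] reverses the letter classes of [rcons v H]; this holds for the labels
   [L], which agree with these letters. *)
rewrite /phi (pprime_mid m); apply: phi_word_unique; rewrite size_rcons sv //.
have LE x : upto n.+1 x -> letter_at (rcons v H) x = L x.
  have [_ Lv' Le'] := labels_upto v.
  rewrite -dom_upto => /domP [//|hx|->]; last by rewrite Le -sv.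
  have xi : x \in iota 1 (size v) by rewrite mem_iota sv.
  by move: Lv'; rewrite -[in RHS]Lv => /eq_in_map /(_ x xi).
case: fL => fL fd; split=> [x Xx|x y Xx Xy xy].
  by have [Xfx _] := iX _ Xx; rewrite !LE // fL // dom_upto.
by rewrite !LE //; apply: fd => //; rewrite dom_upto.
Qed.
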